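(* Let $\langle\mathbb{S},\to\rangle$ be a total transition system and $M=\mathscr{M}_\to$. Then $\rho^\forall_M$ is complete for $\oplus$, i.e. $\rho^\forall_M(\oplus(X))=\rho^\forall_M(\oplus(\rho^\forall_M(X)))$ for all $X\subseteq\mathbb{T}$, if and only if $\to$ is injective, i.e. for all $r,s,t\in\mathbb{S}$, $r\to t$ and $s\to t$ imply $r=s$.
   Context: $\mathbb{T}$ is the set of traces $\langle i,\sigma\rangle$, $i\in\mathbb{Z}$, $\sigma:\mathbb{Z}\to\mathbb{S}$; $X_{\downarrow s}=\{\langle i,\sigma\rangle\in X\mid\sigma_i=s\}$; $\oplus(X)=\{\langle i,\sigma\rangle\mid\langle i+1,\sigma\rangle\in X\}$. A total transition system $\langle\mathbb{S},\to\rangle$ has every state with a successor and a predecessor; $\mathscr{M}_\to=\{\langle i,\sigma\rangle\mid\forall k\in\mathbb{Z}.\ \sigma_k\to\sigma_{k+1}\}$. $\rho^\forall_M(X)=\{\langle i,\sigma\rangle\in M\mid M_{\downarrow\sigma_i}\subseteq X\}$. *)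

(* Defs.v *)
From mathcomp Require Import all_boot all_order all_algebra.
From mathcomp Require Import classical_sets.

Set Implicit Arguments.
Unset Strict Implicit.
Unset Printing Implicit Defensive.

Import GRing.Theory.
Local Open Scope ring_scope.
Local Open Scope classical_set_scope.

(* A trace <i, sigma> is a two-way infinite sequence of states with a
   present time i. *)
Definition trace (S : Type) : Type := (int * (int -> S))%type.

Definition restrict_state (S : Type) (X : set (trace S)) (s : S) :
    set (trace S) :=
  [set p | X p /\ p.2 p.1 = s].

Definition next_op (S : Type) (X : set (trace S)) : set (trace S) :=
  [set p | X (p.1 + 1, p.2)].

Definition total_ts (S : Type) (step : S -> S -> Prop) : Prop :=
  forall s : S, (exists t, step s t) /\ (exists r, step r s).

Definition model (S : Type) (step : S -> S -> Prop) : set (trace S) :=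
  [set p | forall k : int, step (p.2 k) (p.2 (k + 1))].

Definition rho_forall (S : Type) (M X : set (trace S)) : set (trace S) :=
  [set p | M p /\ restrict_state M (p.2 p.1) `<=` X].

Definition complete_for (T : Type) (rho f : set T -> set T) : Prop :=
  forall X : set T, rho (f X) = rho (f (rho X)).

Definition injective_rel (S : Type) (step : S -> S -> Prop) : Prop :=
  forall r s t : S, step r t -> step s t -> r = s.

(* Main.v *)
Require Import Defs.
From mathcomp Require Import all_boot all_order all_algebra.
From mathcomp Require Import boolp classical_sets.

(** Unfolding the definitions, <i, sigma> lies in [rho (next X)] when every
    trace of the model through sigma_i has its shift in [X], and it lies in
    [rho (next (rho X))] when every trace of the model through some successor
    of sigma_i lies in [X].  If the relation is injective, a trace through a
    successor of sigma_i must pass through sigma_i one instant earlier, so the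
    two conditions agree.  Conversely, for r -> t and s -> t, completeness on
    the set of traces whose previous state is r forces every trace through t,
    in particular one through s -> t, to come from r. *)

Import GRing.Theory.
Local Open Scope ring_scope.
Local Open Scope classical_set_scope.

(** Totality gives a successor map [f] and a predecessor map [g]; iterating [f] from [t] and [g]
    from [r] extends the step both ways. *)
Lemma model_through_step (S : Type) (step : S -> S -> Prop) (r t : S) :
  total_ts step -> step r t ->
  exists sigma : int -> S,
    [/\ forall i, model step (i, sigma), sigma 0 = r & sigma 1 = t].
Proof.
move=> tot rt.
have [f fP] := choice (fun s => proj1 (tot s)).
have [g gP] := choice (fun s => proj2 (tot s)).
exists (fun k => match k with
                 | Posz 0 => r
                 | Posz n.+1 => iter n f t
                 | Negz n => iter n.+1 g r
                 end).
split=> // i [[|n]|[|n]] /=.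
- exact: rt.
- rewrite addn1; exact: fP.
- exact: gP.
- rewrite subn1; exact: gP.
Qed.

Lemma rho_forall_sub (S : Type) (M X : set (trace S)) : rho_forall M X `<=` X.
Proof. by move=> p [Mp]; apply. Qed.

Lemma rho_forall_mono (S : Type) (M X Y : set (trace S)) :
  X `<=` Y -> rho_forall M X `<=` rho_forall M Y.
Proof. by move=> XY p [Mp sX]; split=> // q /sX /XY. Qed.

Lemma injective_complete_next (S : Type) (step : S -> S -> Prop) :
  injective_rel step ->
  complete_for (rho_forall (model step)) (@next_op S).
Proof.
move=> inj X; apply/seteqP; split; last first.
  (* Right-to-left inclusion: [rho_forall] is contractive and monotone. *)
  by apply: rho_forall_mono => p; apply: rho_forall_sub.
move=> p [Mp sX]; split=> // q [Mq qp]; split=> // -[j tau] [/= Mtau tauj].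
have step_tau : step (tau (j - 1)) (tau j) by rewrite -{2}(subrK 1 j); apply: Mtau.
have tau_prev : tau (j - 1) = p.2 p.1.
  by rewrite -qp; apply: (inj _ _ _ step_tau); rewrite tauj; apply: Mq.
by have := sX (j - 1, tau) (conj Mtau tau_prev); rewrite /next_op /= subrK.
Qed.

Lemma complete_next_injective (S : Type) (step : S -> S -> Prop) :
  total_ts step -> complete_for (rho_forall (model step)) (@next_op S) ->
  injective_rel step.
Proof.
move=> tot compl r s t rt st.
have [sigma [Msigma sigma0 sigma1]] := model_through_step _ _ _ _ tot rt.
have [tau [Mtau tau0 tau1]] := model_through_step _ _ _ _ tot st.
pose X : set (trace S) := [set p | p.2 (p.1 - 1) = r].
have : rho_forall (model step) (next_op X) (0, sigma).
  split=> [|q [_ /= qr]]; first exact: Msigma.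
  by rewrite /next_op /X /= addrK qr.
(* The shift of [sigma] is at [t], where [tau] also is at time 1; so [(1, tau)] lies in [X], that
   is, [tau 0 = r], while [tau 0 = s]. *)
rewrite compl => -[_ /(_ (0, sigma) (conj (Msigma 0) erefl))].
rewrite /next_op /= add0r => -[_ /(_ (1, tau))].
rewrite /X /= subrr tau0 => H; symmetry; apply: H; split; first exact: Mtau.
by rewrite /= sigma1.
Qed.

Theorem theorem8 (S : Type) (step : S -> S -> Prop) (Htot : total_ts step) :
  complete_for (rho_forall (model step)) (@next_op S) <-> injective_rel step.
Proof.
split; first exact: complete_next_injective.
exact: injective_complete_next.
Qed.
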